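(* Let $H$ be a division ring of finite dimension over its centre, let $\alpha:G\to\mathrm{Gal}(L/H)$ be a finite embedding problem over $H$ and let $\gamma:\mathrm{Gal}(L'/H)\to G$ be a weak solution to $\alpha$. Then there exists a split finite embedding problem $\alpha':G'\to\mathrm{Gal}(L'/H)$ over $H$ such that: 1) $\ker(\alpha)\cong\ker(\alpha')$; 2) every solution $\mathrm{Gal}(F'/H)\to G'$ to $\alpha'$ yields a solution $\mathrm{Gal}(F/H)\to G$ to $\alpha$ with $F\subseteq F'$ (i.e. whenever such a solution to $\alpha'$ exists for $F'$, there is a solution $\mathrm{Gal}(F/H)\to G$ to $\alpha$ with $F\subseteq F'$).
   Context: A division ring is a nonzero (not necessarily commutative) ring in which every nonzero element is invertible. An extension $L/H$ of division rings means that $H$ is a subring of $L$. $\mathrm{Aut}(L/H)$ is the group of automorphisms of $L$ fixing $H$ pointwise. $L/H$ is Galois (in the sense of Artin) if every element of $L$ fixed by all of $\mathrm{Aut}(L/H)$ lies in $H$; then $\mathrm{Gal}(L/H)=\mathrm{Aut}(L/H)$. Let $H$ be a division ring finite-dimensional over its centre. A finite embedding problem over $H$ is an epimorphism $\alpha:G\to\mathrm{Gal}(L/H)$ with $G$ a finite group and $L/H$ a Galois extension. It is split if there is an embedding $\alpha':\mathrm{Gal}(L/H)\to G$ with $\alpha\circ\alpha'=\mathrm{id}$. If $L/H$ and $F/H$ are Galois with finite groups and $L\subseteq F$, the restriction map $\mathrm{res}^{F/H}_{L/H}:\mathrm{Gal}(F/H)\to\mathrm{Gal}(L/H)$ is well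 defined. A weak solution to $\alpha$ is a monomorphism $\beta:\mathrm{Gal}(F/H)\to G$, where $F/H$ is Galois with $L\subseteq F$, such that $\alpha\circ\beta=\mathrm{res}^{F/H}_{L/H}$. A solution is a weak solution that is an isomorphism. *)

(* Defs.v *)
From HB Require Import structures.
From mathcomp Require Import all_boot all_order all_algebra all_fingroup.
From mathcomp Require Import boolp.

Set Implicit Arguments.
Unset Strict Implicit.
Unset Printing Implicit Defensive.

Import GRing.Theory.

Local Open Scope ring_scope.

(* The inherited unitRingType structure is nontrivial (1 != 0). *)
HB.mixin Record UnitRing_isDivRing R of GRing.UnitRing R := {
  divring_unit : forall x : R, x != 0 -> x \is a GRing.unit
}.

#[short(type="divRingType")]
HB.structure Definition DivRing :=
  {R of GRing.UnitRing R & UnitRing_isDivRing R}.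

Definition central (H : divRingType) (z : H) : Prop :=
  forall x : H, z * x = x * z.

(* H has a finite basis e as a vector space over its centre. *)
Definition finite_over_center (H : divRingType) : Prop :=
  exists (n : nat) (e : 'I_n -> H), forall x : H,
    exists! c : {ffun 'I_n -> H},
      (forall i, central (c i)) /\ x = \sum_(i < n) c i * e i.

(* The inclusion of H in L is a ring morphism, which is automatically injective
   because H is a division ring. *)
Record extension (H : divRingType) := Extension {
  ext_ring :> divRingType;
  ext_incl : {rmorphism H -> ext_ring}
}.

(* Inclusions L \subseteq F of extensions of H. *)
Record ext_sub (H : divRingType) (L F : extension H) := ExtSub {
  ext_sub_fun :> {rmorphism L -> F};
  ext_subE : forall h : H, ext_sub_fun (ext_incl L h) = ext_incl F h
}.

(* Aut(L/H), written Gal(L/H) when L/H is Galois; its product is composition,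
   see gal_mulE below. *)
Record Gal (H : divRingType) (L : extension H) := MkGal {
  gal_fun :> {rmorphism L -> L};
  gal_bij : bijective gal_fun;
  gal_fix : forall h : H, gal_fun (ext_incl L h) = ext_incl L h
}.

Section GalGroup.
Variables (H : divRingType) (L : extension H).
Implicit Types s t u : Gal L.

Lemma rmorphism_ext (f g : {rmorphism L -> L}) : f =1 g -> f = g.
Proof.
case: f g => [f [[f0] [f1]]] [g [[g0] [g1]]] /= /funext efg.
case: _ / efg g0 g1 => g0 g1.
by rewrite (Prop_irrelevance f0 g0) (Prop_irrelevance f1 g1).
Qed.

Lemma galP s t : (forall x, s x = t x) -> s = t.
Proof.
case: s t => [f bf ff] [g bg fg] /= /rmorphism_ext efg.
case: _ / efg bg fg => bg fg.
by rewrite (Prop_irrelevance bf bg) (Prop_irrelevance ff fg).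
Qed.

Lemma gal_mul_fix s t (h : H) :
  (s \o t) (ext_incl L h) = ext_incl L h.
Proof. by rewrite /= !gal_fix. Qed.

Definition gal_mul s t : Gal L :=
  MkGal (bij_comp (gal_bij s) (gal_bij t)) (gal_mul_fix s t).

Lemma gal_one_bij : bijective (idfun : L -> L).
Proof. by exists idfun. Qed.

Definition gal_one : Gal L :=
  @MkGal H L idfun gal_one_bij (fun=> erefl).

Lemma gal_inv_subproof s : exists t, forall x, t (s x) = x.
Proof.
have [g sK gK] := gal_bij s.
pose g' : {rmorphism L -> L} := HB.pack g
  (GRing.isZmodMorphism.Build L L g (can2_zmod_morphism sK gK))
  (GRing.isMonoidMorphism.Build L L g (can2_monoid_morphism sK gK)).
have g'_bij : bijective g' by exists s.
have g'_fix h : g' (ext_incl L h) = ext_incl L h.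
  by rewrite -{1}(gal_fix s h); apply: sK.
by exists (MkGal g'_bij g'_fix).
Qed.

Definition gal_inv s : Gal L := sval (cid (gal_inv_subproof s)).

Lemma gal_invK s x : gal_inv s (s x) = x.
Proof. by rewrite /gal_inv; case: cid. Qed.

Lemma gal_mulA : associative gal_mul.
Proof. by move=> s t u; apply: galP. Qed.

Lemma gal_1mul : left_id gal_one gal_mul.
Proof. by move=> s; apply: galP. Qed.

Lemma gal_mul1 : right_id gal_one gal_mul.
Proof. by move=> s; apply: galP. Qed.

Lemma gal_Vmul : left_inverse gal_one gal_inv gal_mul.
Proof. by move=> s; apply: galP => x; apply: gal_invK. Qed.

Lemma gal_mulV : right_inverse gal_one gal_inv gal_mul.
Proof.
move=> s; rewrite -(gal_1mul (gal_mul _ _)) -{1}(gal_Vmul (gal_inv s)).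
by rewrite -gal_mulA (gal_mulA _ s) gal_Vmul gal_1mul gal_Vmul.
Qed.

HB.instance Definition _ := gen_eqMixin (Gal L).
HB.instance Definition _ := gen_choiceMixin (Gal L).
HB.instance Definition _ :=
  isGroup.Build (Gal L) gal_mulA gal_1mul gal_mul1 gal_Vmul gal_mulV.

Lemma gal_mulE s t x : (s * t)%g x = s (t x).
Proof. by []. Qed.

Lemma gal_oneE x : (1%g : Gal L) x = x.
Proof. by []. Qed.

End GalGroup.

(* Galois in the sense of Artin. *)
Definition is_galois (H : divRingType) (L : extension H) : Prop :=
  forall x : L, (forall s : Gal L, s x = x) -> exists h : H, x = ext_incl L h.

Section Kernel.
Variables (G : finGroupType) (A : groupType) (f : {multiplicative G -> A}).

Definition gker : {set G} := [set g | f g == 1%g].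

Lemma gker_group_set : group_set gker.
Proof.
have f1 : f 1%g = 1%g.
  by apply: (@mulgI _ (f 1%g)); rewrite -gmulfM !mulg1.
apply/group_setP; split=> [|x y]; rewrite !inE ?f1 //.
by rewrite gmulfM => /eqP-> /eqP->; rewrite mulg1.
Qed.

Canonical gker_group := Group gker_group_set.

End Kernel.

Section EmbeddingProblem.
Variables (H : divRingType) (L : extension H) (G : finGroupType).
Variable alpha : {multiplicative G -> Gal L}.

Definition embedding_problem : Prop :=
  is_galois L /\ forall s : Gal L, exists g : G, alpha g = s.

Definition split_problem : Prop :=
  exists2 sigma : {multiplicative Gal L -> G},
    injective sigma & forall s : Gal L, alpha (sigma s) = s.

Variables (F : extension H) (i : ext_sub L F).

(* t is the restriction of s to L *)
Definition is_restriction (s : Gal F) (t : Gal L) : Prop :=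
  forall x : L, s (i x) = i (t x).

(* The last clause is alpha \o beta = res; restrictions are unique since i is
   injective. *)
Definition weak_solution (beta : {multiplicative Gal F -> G}) : Prop :=
  [/\ is_galois F, injective beta
    & forall s : Gal F, is_restriction s (alpha (beta s))].

Definition solution (beta : {multiplicative Gal F -> G}) : Prop :=
  weak_solution beta /\ bijective beta.

End EmbeddingProblem.

(* Main.v *)
Require Import Defs.
From HB Require Import structures.
From mathcomp Require Import all_boot all_order all_algebra all_fingroup.
From mathcomp Require Import finfield.
From mathcomp Require Import boolp classical_sets cardinality.

(** The problem alpha' is the second projection of the fibre product of G and
    Gal(L'/H) over Gal(L/H), formed with alpha and alpha \o gamma: it is split
    by s |-> (gamma s, s), and the first projection maps ker alpha'
    isomorphically onto ker alpha.  Let beta' : Gal(F'/H) -> G' be a solution of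
    alpha'.  The division ring F is the subring of F' fixed by the kernel K of
    the composite phi of beta' with the first projection, and phi induces the
    wanted isomorphism from Gal(F/H) to G.

    This uses the Galois correspondence at two points: an automorphism of F'
    which fixes F must lie in K, and every element of Gal(F/H), as well as every
    element of Gal(L/H), must be a restriction ([restriction_surj]).  The first
    can fail for a finite group K containing inner automorphisms: conjugation by
    i has order 2 on the quaternions, and its fixed ring is the field of complex
    numbers, over which there are infinitely many automorphisms.  So the crux is
    that a Galois extension E/H with finite group is outer, i.e. that the
    centralizer of H in E is the centre of E ([finite_outer]).

    The extension is outer because a noncentral c centralizing H would make the
    whole centralizer finite: each of its noncentral elements d is determined by
    the inner automorphisms of d and d + 1, and the map d |-> d + c sends the
    central ones to noncentral ones.  The centre of H is then finite, so H is
    finite, so E is finite because its dimension over H is bounded in terms of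
    Gal(E/H) ([artin_bound]), and E is commutative by Wedderburn's theorem, so
    that c is central after all.

    In an outer extension, Dedekind's argument shows that distinct automorphisms
    over H are linearly independent ([outer_gal_free]).  If K is a finite
    subgroup and t fixes every K-invariant, then t fixes the values of the trace
    T of K, so the automorphisms in K and in t K satisfy the relation
    T - t T = 0; these cosets hence meet and t lies in K ([subgroup_of_fixed]).
    Surjectivity of restriction follows by taking for K the group of
    restrictions. *)

Set Implicit Arguments.
Unset Strict Implicit.
Unset Printing Implicit Defensive.

Import GRing.Theory.

Local Open Scope ring_scope.

(** * Division rings and finiteness *)

Lemma divring_mulVr (R : divRingType) (x : R) : x != 0 -> x^-1 * x = 1.
Proof. by move=> /divring_unit/mulVr. Qed.

Lemma divring_mulrV (R : divRingType) (x : R) : x != 0 -> x * x^-1 = 1.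
Proof. by move=> /divring_unit/mulrV. Qed.

Lemma divring_mul_eq0 (R : divRingType) (x y : R) : x * y = 0 -> x = 0 \/ y = 0.
Proof.
move=> xy0; have [->|nzx] := eqVneq x 0; [by left | right].
by rewrite -[y]mul1r -(divring_mulVr nzx) -mulrA xy0 mulr0.
Qed.

Lemma divring_rmorph_inj (R S : divRingType) (f : {rmorphism R -> S}) :
  injective f.
Proof.
move=> x y /eqP; rewrite -subr_eq0 -rmorphB => /eqP fxy0.
apply/eqP; rewrite -subr_eq0; apply/negPn/negP => /divring_unit/(rmorph_unit f).
by rewrite fxy0 unitr0.
Qed.

(** Gaussian elimination with the coefficients on the left and the unknowns on
    the right, so that it needs no commutativity. *)
Lemma homogeneous_solution (R : divRingType) n (v : 'I_n.+1 -> 'I_n -> R) :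
  exists2 x : 'I_n.+1 -> R,
    exists j, x j != 0 & forall i, \sum_j v j i * x j = 0.
Proof.
elim: n v => [|n IHn] v.
  by exists (fun=> 1); [exists ord0; rewrite oner_eq0 | case].
(* If the last equation is trivial, the last unknown can be set to 0; otherwise
   the last equation is solved for an unknown x_p with nonzero coefficient. *)
have [[p nzp]|v0] := pselect (exists p, v p ord_max != 0); last first.
  pose w (j : 'I_n.+1) (i : 'I_n) := v (lift ord_max j) (lift ord_max i).
  have [x [j nzxj] xP] := IHn w.
  exists (fun k => oapp x 0 (unlift ord_max k)).
    by exists (lift ord_max j); rewrite liftK.
  move=> i; have [i'|] := unliftP ord_max i; last first.
    move=> ->; apply: big1 => k _; suff -> : v k ord_max = 0 by rewrite mul0r.
    by apply: contra_notP v0 => /eqP; exists k.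
  move=> ->; rewrite (bigD1_ord ord_max) //= unlift_none mulr0 add0r.
  by under eq_bigr do rewrite liftK; apply: xP.
pose q j := (v p ord_max)^-1 * v j ord_max.
pose w (j : 'I_n.+1) (i : 'I_n) :=
  v (lift p j) (lift ord_max i) - v p (lift ord_max i) * q (lift p j).
have [x [j nzxj] xP] := IHn w.
pose y := - \sum_j q (lift p j) * x j.
exists (fun k => oapp x y (unlift p k)).
  by exists (lift p j); rewrite liftK.
move=> i; rewrite (bigD1_ord p) //= unlift_none /=.
under eq_bigr do rewrite liftK /=.
have [i'|] := unliftP ord_max i => ->.
  apply: etrans (xP i'); rewrite /y mulrN mulr_sumr addrC -sumrB.
  by apply: eq_bigr => k _; rewrite /w mulrBl !mulrA.
rewrite /y mulrN mulr_sumr addrC -sumrB big1 // => k _.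
by rewrite /q !mulrA divring_mulrV // mul1r subrr.
Qed.

Lemma finite_sums (A M : Type) (op : M -> M -> M) (idx : M) n
    (f : 'I_n -> A -> M) (S : set A) :
  finite_set S ->
  finite_set [set \big[op/idx]_(i < n) f i (a i)
             | a in [set a | forall i, S (a i)]].
Proof.
move=> finS; elim: n f => [|n IHn] f.
  apply: sub_finite_set (finite_set1 idx) => _ [a _ <-] /=.
  by rewrite big_ord0.
have := finite_image2 op (finite_image (f ord0) finS)
  (IHn (fun i => f (lift ord0 i))).
apply: sub_finite_set => _ [a Sa <-] /=.
rewrite big_ord_recl; exists (f ord0 (a ord0)); first by exists (a ord0).
by exists (\big[op/idx]_(i < n) f (lift ord0 i) (a (lift ord0 i))) => //;
   exists (fun i => a (lift ord0 i)).
Qed.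

(** Wedderburn's little theorem, for a division ring without a chosen
    enumeration. *)
Lemma finite_divring_comm (R : divRingType) :
  finite_set [set: R] -> forall x y : R, x * y = y * x.
Proof.
case/finite_seqP => r rP.
have rE : finite_axiom (undup r).
  move=> x; rewrite count_uniq_mem ?undup_uniq // mem_undup.
  by have : [set: R]%classic x by []; rewrite rP /= => ->.
pose fR : finUnitRingType := HB.pack R
  (Choice_isCountable.Build R (@fin_pickleK _ _ rE)) (isFinite.Build R rE).
apply: (@finDomain_mulrC fR) => x y /divring_mul_eq0[] /eqP ->//.
by rewrite orbT.
Qed.

(** * Finite Galois groups bound the dimension *)

Lemma galVK (H : divRingType) (E : extension H) (s : Gal E) x :
  s ((s^-1)%g x) = x.
Proof. by rewrite -gal_mulE mulgV. Qed.

(** Artin's descent, by induction on the number of nonzero x_j: once x is scaled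
    on the right to have an entry 1, either Gal(E/H) fixes all its entries,
    which then come from H, or t x - x is for some t a nonzero solution with
    smaller support.  The hypothesis on all s, and not only on s = 1, is what
    makes t x a solution again. *)
Lemma galois_descent (H : divRingType) (E : extension H) n
    (u : 'I_n -> E) (x : 'I_n -> E) :
    is_galois E -> (exists j, x j != 0) ->
    (forall s : Gal E, \sum_j s (u j) * x j = 0) ->
  exists2 y : 'I_n -> H,
    exists j, y j != 0 & \sum_j u j * ext_incl E (y j) = 0.
Proof.
move=> galE; have [k lek] := ubnP #|[pred j | x j != 0]|.
elim: k x lek => // k IHk x lek [p nzxp] xP.
pose z j := x j * (x p)^-1.
have zP (s : Gal E) : \sum_j s (u j) * z j = 0.
  under eq_bigr do rewrite /z mulrA.
  by rewrite -mulr_suml xP mul0r.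
have zp : z p = 1 by rewrite /z divring_mulrV.
have [z_fix|] := pselect (forall j (t : Gal E), t (z j) = z j).
  have [y yP] := choice (fun j => galE (z j) (z_fix j)).
  exists y.
    exists p; apply: contra_eq_neq zp => yp0.
    by rewrite yP yp0 rmorph0 eq_sym oner_eq0.
  rewrite -[RHS](zP 1%g).
  by apply: eq_bigr => j _; rewrite yP gal_oneE.
move=> /existsNP[q /existsNP[t tzq]].
apply: (IHk (fun j => t (z j) - z j)).
- rewrite ltnS in lek; apply: leq_trans lek; apply: proper_card.
  apply/properP; split.
    apply/fintype.subsetP => j; rewrite !inE; apply: contra_neq => xj0.
    by rewrite /z xj0 mul0r rmorph0 subrr.
  by exists p; rewrite !inE ?nzxp // zp rmorph1 subrr eqxx.
- by exists q; rewrite subr_eq0; apply/eqP.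
move=> s; under eq_bigr do rewrite mulrBr.
rewrite sumrB zP subr0.
transitivity (t (\sum_j (t^-1 * s)%g (u j) * z j)); last by rewrite zP rmorph0.
rewrite rmorph_sum.
by apply: eq_bigr => j _; rewrite rmorphM gal_mulE galVK.
Qed.

(** For n = |Gal(E/H)| + 1, the descent applies to a solution of the system with
    one equation for each element of the Galois group. *)
Lemma artin_bound (H : divRingType) (E : extension H) :
    is_galois E -> finite_set [set: Gal E] ->
  exists n, forall u : 'I_n -> E, exists2 y : 'I_n -> H,
    exists j, y j != 0 & \sum_j u j * ext_incl E (y j) = 0.
Proof.
move=> galE /finite_seqP[r rE]; exists (size r).+1 => u.
have [x nzx xP] :=
  homogeneous_solution (fun j (i : 'I_(size r)) => nth 1%g r i (u j)).
apply: galois_descent nzx _ => // s.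
have sr : s \in r by have : [set: Gal E]%classic s by []; rewrite rE.
have ltsr : (index s r < size r)%N by rewrite index_mem.
by rewrite -[RHS](xP (Ordinal ltsr)) /= nth_index.
Qed.

(** Over a finite H, finite families have finite spans, so in an infinite E an
    independent family could be extended forever. *)
Lemma finite_over_finite_base (H : divRingType) (E : extension H) :
    is_galois E -> finite_set [set: Gal E] ->
  finite_set [set: H] -> finite_set [set: E].
Proof.
move=> galE finG finH; have [n depE] := artin_bound galE finG.
apply: contrapT => infE.
have indepE k : exists u : 'I_k -> E, forall y : 'I_k -> H,
    \sum_j u j * ext_incl E (y j) = 0 -> forall j, y j = 0.
  elim: k => [|k [u uP]]; first by exists (fun=> 0) => y _ [].
  have [v vP] : exists v, forall y : 'I_k -> H,
      v != \sum_j u j * ext_incl E (y j).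
    apply: contra_notP infE => /forallNP spanE.
    apply: sub_finite_set
      (finite_sums +%R 0 (fun j a => u j * ext_incl E a) finH) => v _ /=.
    have /existsNP[y /negP/negPn/eqP ->] := spanE v.
    by exists y.
  exists (fun j => oapp u v (unlift ord_max j)) => y.
  rewrite (bigD1_ord ord_max) //= unlift_none.
  under eq_bigr do rewrite liftK.
  move=> /eqP; rewrite addr_eq0 => /eqP /= vyE.
  have [y0|nzy] := eqVneq (y ord_max) 0.
    move=> j; have [i|] := unliftP ord_max j => -> //.
    apply: (uP (y \o lift ord_max)).
    by apply/eqP; rewrite -oppr_eq0 -vyE y0 rmorph0 mulr0.
  case/eqP: (vP (fun i => - y (lift ord_max i) / y ord_max)).
  rewrite -[v]mulr1 -(rmorph1 (ext_incl E)) -(divring_mulrV nzy) rmorphM mulrA.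
  rewrite vyE.
  rewrite -sumrN mulr_suml; apply: eq_bigr => i _.
  by rewrite rmorphM rmorphN !mulNr mulrN mulrA.
have [u uP] := indepE n; have [y [j nzy] /uP y0] := depE u.
by rewrite y0 eqxx in nzy.
Qed.

(** * Finite Galois extensions are outer *)

Definition centralizes_base (H : divRingType) (E : extension H) (c : E) :=
  forall h : H, c * ext_incl E h = ext_incl E h * c.

(** The converse inclusion being clear, this says that the centralizer of H in E
    is the centre of E, i.e. that the only inner automorphism of E over H is the
    identity. *)
Definition outer (H : divRingType) (E : extension H) : Prop :=
  forall c : E, centralizes_base c -> central c.

Lemma inner_gal (H : divRingType) (E : extension H) (c : E) :
    c != 0 -> centralizes_base c ->
  exists s : Gal E, forall x, s x = c * x / c.
Proof.
move=> nzc cH; pose f x := c * x / c.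
have fB : zmod_morphism f by move=> x y; rewrite /f mulrBr mulrBl.
have fM : monoid_morphism f.
  split=> [|x y]; rewrite /f; first by rewrite mulr1 divring_mulrV.
  by rewrite !mulrA (mulrVK (divring_unit _ nzc)).
pose s : {rmorphism E -> E} := HB.pack f
  (GRing.isZmodMorphism.Build E E f fB) (GRing.isMonoidMorphism.Build E E f fM).
have s_bij : bijective s.
  exists (fun x => c^-1 * x * c) => x; rewrite /= /f.
    by rewrite !mulrA divring_mulVr // mul1r -mulrA divring_mulVr // mulr1.
  by rewrite !mulrA divring_mulrV // mul1r -mulrA divring_mulrV // mulr1.
have s_fix h : s (ext_incl E h) = ext_incl E h.
  by rewrite /= /f cH -mulrA divring_mulrV // mulr1.
by exists (MkGal s_bij s_fix).
Qed.

Lemma same_inner_central (R : divRingType) (c d : R) :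
    c != 0 -> d != 0 -> (forall x, c * x / c = d * x / d) ->
  central (d^-1 * c).
Proof.
move=> nzc nzd cd x; apply: (can_inj (mulKr (divring_unit _ nzd))).
rewrite !mulrA divring_mulrV // mul1r.
by rewrite -[LHS]mulr1 -(divring_mulVr nzc) mulrA cd -!mulrA.
Qed.

Lemma central0 (R : divRingType) : central (0 : R).
Proof. by move=> x; rewrite mul0r mulr0. Qed.

Lemma central1 (R : divRingType) : central (1 : R).
Proof. by move=> x; rewrite mul1r mulr1. Qed.

Lemma centralB (R : divRingType) (a b : R) :
  central a -> central b -> central (a - b).
Proof. by move=> ca cb x; rewrite mulrBl mulrBr ca cb. Qed.

Lemma noncentral_shift_neq0 (R : divRingType) (a z : R) :
  ~ central a -> central z -> a + z != 0.
Proof.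
move=> nca cz; apply: contra_notN nca; rewrite addr_eq0 => /eqP ->.
by rewrite -[- z]add0r; apply: centralB cz; apply: central0.
Qed.

(** Elements with the same inner automorphism differ by a central factor, so
    c = d w and c + 1 = (d + 1) w1 with w and w1 central.  Then
    d (w - w1) = w1 - 1, which makes d central unless w = w1 = 1.  This is the
    injectivity which bounds the noncentral part of the centralizer by pairs of
    Galois automorphisms. *)
Lemma inner_pair_inj (R : divRingType) (c d : R) :
    ~ central c -> ~ central d ->
    (forall x, c * x / c = d * x / d) ->
    (forall x, (c + 1) * x / (c + 1) = (d + 1) * x / (d + 1)) ->
  c = d.
Proof.
have [cent0 cent1] := (@central0 R, @central1 R).
move=> ncc ncd inn1 inn2.
have nzc : c != 0 by rewrite -[c]addr0 noncentral_shift_neq0.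
have nzd : d != 0 by rewrite -[d]addr0 noncentral_shift_neq0.
have nzc1 : c + 1 != 0 by rewrite noncentral_shift_neq0.
have nzd1 : d + 1 != 0 by rewrite noncentral_shift_neq0.
have := same_inner_central nzc1 nzd1 inn2.
have := same_inner_central nzc nzd inn1.
set w := _ * c; set w1 := _ * (c + 1) => cw cw1.
have cE : c = d * w by rewrite /w mulrA divring_mulrV ?mul1r.
have c1E : c + 1 = (d + 1) * w1 by rewrite /w1 mulrA divring_mulrV ?mul1r.
have dE : d * (w - w1) = w1 - 1.
  rewrite mulrBr -cE -[c in LHS](addrK 1) c1E mulrDl mul1r.
  by rewrite addrAC [_ + w1]addrC addrK.
have [ww1|nww1] := eqVneq w w1.
  move/eqP: dE; rewrite ww1 subrr mulr0 eq_sym subr_eq0 -ww1 => /eqP w1E.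
  by rewrite cE w1E mulr1.
case: ncd; rewrite -subr_eq0 in nww1.
rewrite -[d]mulr1 -(divring_mulrV nww1) mulrA dE => x; apply/commr_sym.
by apply: commrM; [|apply: commrV]; apply: commrB;
  first [exact: commr1 | exact/esym/cw | exact/esym/cw1].
Qed.

(** This is the only place where the dimension of H over its centre matters: it
    makes H finite as soon as its centre, which centralizes H in E, is
    finite. *)
Lemma finite_outer (H : divRingType) (E : extension H) :
    finite_over_center H -> is_galois E -> finite_set [set: Gal E] -> outer E.
Proof.
move=> [n [e eP]] galE finG c cH; apply: contrapT => ncc.
have cH1 : centralizes_base (1 : E) by move=> h; rewrite mul1r mulr1.
have cHD (a b : E) : centralizes_base a -> centralizes_base b ->
    centralizes_base (a + b).
  by move=> aH bH h; rewrite mulrDl mulrDr aH bH.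
have innP (d : E) : exists s : Gal E,
    d != 0 -> centralizes_base d -> forall x, s x = d * x / d.
  have [dP|ndP] := pselect (d != 0 /\ centralizes_base d); last first.
    by exists 1%g => nzd dH; case: ndP.
  by case: dP => nzd dH; have [s sP] := inner_gal nzd dH; exists s.
have [inn {}innP] := choice innP.
pose N := [set d : E | centralizes_base d /\ ~ central d]%classic.
have finN : finite_set N.
  pose f (d : E) := (inn d, inn (d + 1)).
  have f_inj : {in N &, injective f}.
    move=> d d' /set_mem[dH ncd] /set_mem[d'H ncd'] [eq1 eq2].
    have nz0 (a : E) : ~ central a -> a != 0.
      rewrite -[a in a != 0]addr0 => /noncentral_shift_neq0; apply.
      exact: central0.
    have nz1 (a : E) : ~ central a -> a + 1 != 0.
      by move/noncentral_shift_neq0; apply; apply: central1.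
    apply: inner_pair_inj => // x.
      by rewrite -!innP ?eq1 ?nz0.
    by rewrite -!innP ?eq2 ?nz1 //; apply: cHD.
  rewrite -(eq_finite_set (inj_card_eq f_inj)).
  apply: sub_finite_set (finite_setX finG finG).
  by [].
have finC : finite_set [set d : E | centralizes_base d]%classic.
  (* A central d is the difference of the noncentral elements d + c and c. *)
  have finNc := finite_image (fun d => d - c) finN.
  have : finite_set (N `|` [set d - c | d in N])%classic by rewrite finite_setU.
  apply: sub_finite_set => d /= dH.
  have [cd|] := pselect (central d); [right | by left].
  exists (d + c); last by rewrite addrK.
  split; first exact: cHD.
  by apply: contra_not ncc => cdc; rewrite -[c](addKr d) addrC; apply: centralB.
have finZH : finite_set [set z : H | central z]%classic.
  have := finite_preimage (in2W (@divring_rmorph_inj _ _ (ext_incl E))) finC.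
  by apply: sub_finite_set => z cz h; rewrite -!rmorphM cz.
have finH : finite_set [set: H].
  apply: sub_finite_set
    (finite_sums +%R 0 (fun i z => z * e i) finZH) => x _ /=.
  by have [a [[ac ->] _]] := eP x; exists a.
apply: ncc => x; apply: finite_divring_comm.
exact: finite_over_finite_base.
Qed.

(** * Artin's theorem for outer extensions *)

(** Dedekind's independence of characters: scale the relation on the left so
    that s0 has coefficient 1 and each other s a coefficient b_s.  Subtracting
    s0(x) times its value at y from its value at x y removes s0, so that by
    induction b_s s(x) = s0(x) b_s for all x.  For x in H this says that b_s
    centralizes H; it is thus central, and s = s0 unless b_s = 0. *)
Lemma outer_gal_free (H : divRingType) (E : extension H) (r : seq (Gal E))
    (a : Gal E -> E) :
    outer E -> uniq r -> (forall x, \sum_(s <- r) a s * s x = 0) ->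
  forall s, s \in r -> a s = 0.
Proof.
move=> outE; elim: r a => [|s0 r IHr] a //= /andP[s0r Ur] a0.
have a0_only : a s0 = 0 -> forall s, s \in s0 :: r -> a s = 0.
  move=> as0 s; rewrite inE => /predU1P[-> //|].
  by apply: IHr => // x; have := a0 x; rewrite big_cons as0 mul0r add0r.
apply: a0_only; apply: contrapT => /eqP nzas0.
pose b s := (a s0)^-1 * a s.
have b0 x : s0 x + \sum_(s <- r) b s * s x = 0.
  transitivity ((a s0)^-1 * \sum_(s <- s0 :: r) a s * s x); last first.
    by rewrite a0 mulr0.
  rewrite big_cons mulrDr mulrA divring_mulVr // mul1r mulr_sumr.
  by under [in RHS]eq_bigr do rewrite mulrA.
have b_eq s x : s \in r -> b s * s x - s0 x * b s = 0.
  move: s; apply: (IHr (fun s => b s * s x - s0 x * b s)) => // y.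
  transitivity (s0 (x * y) + \sum_(s <- r) b s * s (x * y) -
                s0 x * (s0 y + \sum_(s <- r) b s * s y)); last first.
    by rewrite !b0 mulr0 subr0.
  rewrite rmorphM mulrDr opprD addrACA subrr add0r mulr_sumr -sumrB.
  by apply: eq_bigr => s _; rewrite rmorphM mulrBl !mulrA.
have br0 s : s \in r -> b s = 0.
  move=> sr; apply: contrapT => /eqP nzbs.
  have bcE x : b s * s x = s0 x * b s by apply/eqP; rewrite -subr_eq0 b_eq.
  have bc : central (b s) by apply: outE => h; have := bcE (ext_incl E h);
    rewrite !gal_fix.
  suff ss0 : s = s0 by rewrite -ss0 sr in s0r.
  apply: galP => x; apply: (can_inj (mulKr (divring_unit _ nzbs))).
  by rewrite bcE bc.
have := b0 1; rewrite big_seq big1 ?addr0 ?rmorph1; last first.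
  by move=> s /br0->; rewrite mul0r.
by move/eqP; rewrite oner_eq0.
Qed.

(** If t is not in K, the trace T of K and t T involve disjoint sets of
    automorphisms, and the equality T = t T contradicts their independence. *)
Lemma subgroup_of_fixed (H : divRingType) (E : extension H)
    (K : set (Gal E)) (t : Gal E) :
    outer E -> finite_set K -> K 1%g ->
    (forall u v, K u -> K v -> K (u * v)%g) -> (forall u, K u -> K (u^-1)%g) ->
    (forall x, (forall s, K s -> s x = x) -> t x = x) ->
  K t.
Proof.
move=> outE /finite_seqP[r' r'P] K1 KM KV tfix; pose r := undup r'.
have rP s : K s <-> s \in r by rewrite mem_undup r'P.
have Ur : uniq r by apply: undup_uniq.
apply/rP/negPn/negP => tr.
have tr_r u : u \in r -> (t * u)%g \notin r.
  move=> /rP Ku; apply: contra tr => /rP Ktu.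
  by rewrite -[t](mulgK u); apply/rP/KM => //; apply: KV.
pose T x := \sum_(s <- r) s x.
have T_fix x : t (T x) = T x.
  apply: tfix => s Ks.
  have sub_sr : {subset map (mulg s) r <= r}.
    by move=> _ /mapP[u /rP Ku ->]; apply/rP/KM.
  have Usr : uniq (map (mulg s) r) by rewrite map_inj_uniq //; apply: mulgI.
  have [|_ eq_sr] := uniq_min_size Usr sub_sr; first by rewrite size_map.
  rewrite /T -[RHS](perm_big _ (uniq_perm Usr Ur eq_sr)) big_map rmorph_sum.
  by apply: eq_bigr => u _; rewrite gal_mulE.
have Ucat : uniq (r ++ map (mulg t) r).
  rewrite cat_uniq Ur map_inj_uniq ?Ur ?andbT /=; last exact: mulgI.
  by apply/hasPn => _ /mapP[u ur ->]; apply: tr_r.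
pose a s : E := if s \in r then 1 else -1.
suff a0 x : \sum_(s <- r ++ map (mulg t) r) a s * s x = 0.
  have r1 : 1%g \in r by apply/rP.
  have := outer_gal_free outE Ucat a0 (s := 1%g).
  by rewrite mem_cat /a r1 => /(_ isT)/eqP; rewrite oner_eq0.
rewrite big_cat big_map /= -[RHS](subrr (T x)) -[in X in _ - X]T_fix.
rewrite /T rmorph_sum -sumrN; congr (_ + _); rewrite !big_seq.
  by apply: eq_bigr => s sr; rewrite /a sr mul1r.
by apply: eq_bigr => s /tr_r/negPf ntsr; rewrite /a ntsr mulN1r.
Qed.

(** * Restriction of automorphisms *)

Lemma ext_sub_inj (H : divRingType) (L F : extension H) (i : ext_sub L F) :
  injective i.
Proof. exact: divring_rmorph_inj. Qed.

Lemma restriction_inj (H : divRingType) (L F : extension H)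
    (i : ext_sub L F) s t t' :
  is_restriction i s t -> is_restriction i s t' -> t = t'.
Proof.
move=> st st'; apply: galP => x; apply: (@ext_sub_inj _ _ _ i).
by rewrite -st st'.
Qed.

Lemma restrictionM (H : divRingType) (L F : extension H) (i : ext_sub L F)
    s s' t t' :
  is_restriction i s t -> is_restriction i s' t' ->
  is_restriction i (s * s')%g (t * t')%g.
Proof. by move=> st st' x; rewrite !gal_mulE st' st. Qed.

Lemma restrictionV (H : divRingType) (L F : extension H) (i : ext_sub L F)
    s t :
  is_restriction i s t -> is_restriction i s^-1%g t^-1%g.
Proof.
by move=> st x; rewrite -{1}[x](galVK t) -st -gal_mulE mulVg.
Qed.

(** The restrictions form a finite subgroup of Gal(L/H) whose fixed ring is H,
    because F/H is Galois; and L inherits outerness from F. *)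
Lemma restriction_surj (H : divRingType) (L F : extension H) (i : ext_sub L F) :
    outer F -> is_galois F -> finite_set [set: Gal F] ->
    (forall s, exists t, is_restriction i s t) ->
  forall t, exists s, is_restriction i s t.
Proof.
move=> outF galF finF /choice[res resP].
have outL : outer L.
  move=> c cH x; apply: (@ext_sub_inj _ _ _ i); rewrite !rmorphM.
  by apply: outF => h; rewrite -(ext_subE i) -!rmorphM cH.
move=> t; pose K := [set t | exists s, is_restriction i s t]%classic.
apply: (@subgroup_of_fixed _ _ K) => //.
- apply: sub_finite_set (finite_image res finF) => u [s su].
  by exists s => //; apply: restriction_inj (resP s) su.
- by exists 1%g.
- by move=> u v [s su] [s' sv]; exists (s * s')%g; apply: restrictionM.
- by move=> u [s su]; exists s^-1%g; apply: restrictionV.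
move=> x xfix; have [|h ixh] := galF (i x).
  by move=> s; rewrite resP xfix //; exists s.
by rewrite -(ext_subE i) in ixh; rewrite (ext_sub_inj ixh) gal_fix.
Qed.

(** * The fixed ring of a set of automorphisms *)

Section FixedSubring.
Variables (H : divRingType) (E : extension H) (K : set (Gal E)).

Definition fixed_by : pred E := fun x => `[< forall s, K s -> s x = x >].

Lemma fixed_byP x : reflect (forall s, K s -> s x = x) (x \in fixed_by).
Proof. exact: asboolP. Qed.

Lemma fixed_by_divring_closed : divring_closed fixed_by.
Proof.
split; first by apply/fixed_byP => s _; rewrite rmorph1.
  move=> x y /fixed_byP fx /fixed_byP fy.
  by apply/fixed_byP => s Ks; rewrite rmorphB fx ?fy.
move=> x y /fixed_byP fx /fixed_byP fy; apply/fixed_byP => s Ks.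
have [->|/divring_unit Uy] := eqVneq y 0.
  by rewrite invr0 mulr0 rmorph0.
by rewrite rmorph_div // fx // fy.
Qed.

HB.instance Definition _ := GRing.isDivringClosed.Build E fixed_by
  fixed_by_divring_closed.

Definition fixed_ring := {x : E | x \in fixed_by}.
HB.instance Definition _ := SubChoice.on fixed_ring.
HB.instance Definition _ := [SubChoice_isSubUnitRing of fixed_ring by <:].

Lemma fixed_ring_unit (x : fixed_ring) : x != 0 -> x \is a GRing.unit.
Proof.
move=> nzx; have nzvx : val x != 0.
  by rewrite -(rmorph0 (val : fixed_ring -> E)) (inj_eq val_inj).
have Vx : (val x)^-1 \in fixed_by by rewrite rpredV; apply: (valP x).
apply/unitrP; exists (Sub (val x)^-1 Vx).
by split; apply: val_inj;
  rewrite rmorphM rmorph1 /= ?divring_mulVr ?divring_mulrV.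
Qed.

HB.instance Definition _ :=
  UnitRing_isDivRing.Build fixed_ring fixed_ring_unit.

Lemma base_fixed h : ext_incl E h \in fixed_by.
Proof. by apply/fixed_byP => s _; rewrite gal_fix. Qed.

Definition fixed_base (h : H) : fixed_ring := Sub (ext_incl E h) (base_fixed h).

Lemma fixed_base_zmod : zmod_morphism fixed_base.
Proof. by move=> x y; apply: val_inj; rewrite rmorphB !SubK rmorphB. Qed.

Lemma fixed_base_monoid : monoid_morphism fixed_base.
Proof.
by split=> [|x y]; apply: val_inj; rewrite ?rmorphM !SubK ?rmorph1 ?rmorphM.
Qed.

HB.instance Definition _ :=
  GRing.isZmodMorphism.Build H fixed_ring fixed_base fixed_base_zmod.
HB.instance Definition _ :=
  GRing.isMonoidMorphism.Build H fixed_ring fixed_base fixed_base_monoid.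

Definition fixed_ext : extension H := Extension fixed_base.

Definition fixed_incl : ext_sub fixed_ext E :=
  @ExtSub H fixed_ext E val (fun=> SubK _ _).

Lemma fixed_lift (L : extension H) (f : ext_sub L E) :
    (forall x, f x \in fixed_by) ->
  exists j : ext_sub L fixed_ext, forall x, fixed_incl (j x) = f x.
Proof.
move=> fK; pose g x : fixed_ring := Sub (f x) (fK x).
have gB : zmod_morphism g.
  by move=> x y; apply: val_inj; rewrite !(rmorphB, SubK).
have gM : monoid_morphism g.
  by split=> [|x y]; apply: val_inj; rewrite !(rmorph1, rmorphM, SubK).
pose j : {rmorphism L -> fixed_ring} := HB.pack g
  (GRing.isZmodMorphism.Build _ _ g gB) (GRing.isMonoidMorphism.Build _ _ g gM).
have jE h : j (ext_incl L h) = ext_incl fixed_ext h.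
  by apply: val_inj; rewrite /= ext_subE.
by exists (@ExtSub H L fixed_ext j jE).
Qed.

End FixedSubring.

Lemma multiplicative1 (A B : groupType) (f : {multiplicative A -> B}) :
  f 1%g = 1%g.
Proof. by apply: (@mulgI _ (f 1%g)); rewrite -gmulfM !mulg1. Qed.

Lemma multiplicativeV (A B : groupType) (f : {multiplicative A -> B}) x :
  f (x^-1)%g = ((f x)^-1)%g.
Proof.
by apply: (@mulgI _ (f x)); rewrite -gmulfM !mulgV multiplicative1.
Qed.

(** If the set K is stable under conjugation, every automorphism maps its fixed
    ring to itself. *)
Lemma fixed_restriction (H : divRingType) (E : extension H) (K : set (Gal E))
    (s : Gal E) :
    (forall u v, K u -> K (v^-1 * u * v)%g) ->
  exists t : Gal (fixed_ext K), is_restriction (fixed_incl K) s t.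
Proof.
move=> nK.
have sF (u : Gal E) (x : fixed_ring K) : u (val x) \in fixed_by K.
  apply/fixed_byP => v Kv.
  have /fixed_byP/(_ _ (nK v u Kv)) := valP x.
  by rewrite !gal_mulE => /(congr1 u); rewrite galVK.
pose f (u : Gal E) (x : fixed_ring K) : fixed_ring K :=
  Sub (u (val x)) (sF u x).
have fB : zmod_morphism (f s).
  by move=> x y; apply: val_inj; rewrite !(rmorphB, SubK).
have fM : monoid_morphism (f s).
  by split=> [|x y]; apply: val_inj; rewrite !(rmorph1, rmorphM, SubK).
pose t : {rmorphism fixed_ring K -> fixed_ring K} := HB.pack (f s)
  (GRing.isZmodMorphism.Build _ _ (f s) fB)
  (GRing.isMonoidMorphism.Build _ _ (f s) fM).
have t_bij : bijective t.
  by exists (f s^-1%g) => x; apply: val_inj; rewrite /= -gal_mulE ?mulVg ?mulgV.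
have t_fix h : t (ext_incl (fixed_ext K) h) = ext_incl (fixed_ext K) h.
  by apply: val_inj; rewrite /= gal_fix.
by exists (@MkGal H (fixed_ext K) t t_bij t_fix) => x.
Qed.

(** The fundamental theorem for the subgroup ker phi: by surjectivity of
    restriction, the Galois group of its fixed ring F is the quotient of
    Gal(E/H) by the automorphisms fixing F, and these are no more than ker phi
    by [subgroup_of_fixed]. *)
Lemma galois_quotient (H : divRingType) (E : extension H) (G : finGroupType)
    (phi : {multiplicative Gal E -> G}) :
    outer E -> is_galois E -> finite_set [set: Gal E] ->
    let F := fixed_ext [set s | phi s = 1%g]%classic in
    let k := fixed_incl [set s | phi s = 1%g]%classic in
  is_galois F /\ exists beta : {multiplicative Gal F -> G},
    [/\ injective beta,
        forall s, exists t, is_restriction k s t,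
        forall t, exists s, is_restriction k s t
      & forall s t, is_restriction k s t -> beta t = phi s].
Proof.
move=> outE galE finG; set K := [set s | _]%classic => F k.
have resP s : exists t, is_restriction k s t.
  apply: fixed_restriction => u v /= Ku.
  by rewrite /K /= !gmulfM Ku mulg1 -gmulfM mulVg multiplicative1.
split.
  move=> x xfix; have [s|h xh] := galE (val x).
    by have [t /(_ x)] := resP s; rewrite xfix.
  by exists h; apply: val_inj.
have [sec secP] := choice (restriction_surj outE galE finG resP).
have well_def s s' t : is_restriction k s t -> is_restriction k s' t ->
    phi s = phi s'.
  move=> st s't; suff : K (s^-1 * s')%g.
    by rewrite /K /= gmulfM multiplicativeV => /(congr1 (mulg (phi s)));
       rewrite mulKVg mulg1.
  have := restrictionM (restrictionV st) s't; rewrite mulVg => fix_k.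
  apply: subgroup_of_fixed => //.
  - exact: sub_finite_set finG.
  - exact: multiplicative1.
  - by move=> u v; rewrite /K /= gmulfM => -> ->; rewrite mulg1.
  - by move=> u; rewrite /K /= multiplicativeV => ->; rewrite invg1.
  by move=> x xK; have /fixed_byP xF := xK; apply: (fix_k (Sub x xF)).
pose f t := phi (sec t).
have fM : {morph f : t u / (t * u)%g}.
  move=> t u; rewrite /f -gmulfM; apply: well_def (secP _) _.
  exact: restrictionM.
exists (HB.pack_for {multiplicative Gal F -> G} f
  (isMultiplicative.Build _ _ f fM)).
split=> //; last 2 first.
- by move=> t; exists (sec t).
- by move=> s t; apply: well_def.
move=> t u /= ftu; apply: galP => x; apply: (@ext_sub_inj _ _ _ k).
rewrite -!secP; have /fixed_byP/(_ ((sec t)^-1 * sec u)%g) := valP x.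
rewrite /K /= gmulfM multiplicativeV.
have -> : phi (sec t) = phi (sec u) by [].
by rewrite mulVg => /(_ erefl) /(congr1 (sec t)) /=; rewrite galVK.
Qed.

(** * Fibre products *)

Section FibreProduct.
Variables (A B : groupType) (G : finGroupType).
Variables (alpha : {multiplicative G -> A}) (gamma : {multiplicative B -> G}).

(** The elements b of B are represented by their images under gamma, assumed
    injective below, since the group B carries no finite structure while G * G
    does.  Thus this is the fibre product of alpha and alpha \o gamma. *)
Definition fibre_set : {set G * G} :=
  [set p : G * G | `[< exists2 b, p.2 = gamma b & alpha p.1 = alpha p.2 >]].

Lemma fibreP p :
  reflect (exists2 b, p.2 = gamma b & alpha p.1 = alpha p.2) (p \in fibre_set).
Proof. by rewrite inE; apply: asboolP. Qed.

Lemma fibre_group_set : group_set fibre_set.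
Proof.
apply/group_setP; split=> [|p q /fibreP[b pb ap] /fibreP[c qc aq]].
  by apply/fibreP; exists 1%g; rewrite ?multiplicative1.
apply/fibreP; exists (b * c)%g; first by rewrite gmulfM -pb -qc.
by rewrite !gmulfM ap aq.
Qed.

Canonical fibre_group := Group fibre_group_set.

Definition fibre : finGroupType := subg_of fibre_group.

Definition fibre_fst (x : fibre) : G := (sgval x).1.

Lemma fibre_fstM : {morph fibre_fst : x y / (x * y)%g}.
Proof. by []. Qed.

HB.instance Definition _ := isMultiplicative.Build fibre G fibre_fst fibre_fstM.

Lemma fibre_snd_subproof (x : fibre) : exists b, (sgval x).2 = gamma b.
Proof. by have /fibreP[b] := subgP x; exists b. Qed.

Definition fibre_snd (x : fibre) : B := sval (cid (fibre_snd_subproof x)).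

Lemma fibre_sndE x : gamma (fibre_snd x) = (sgval x).2.
Proof. by rewrite /fibre_snd; case: cid. Qed.

Lemma fibre_eq x : alpha (fibre_fst x) = alpha (gamma (fibre_snd x)).
Proof. by rewrite fibre_sndE; have /fibreP[] := subgP x. Qed.

Hypothesis gamma_inj : injective gamma.

Lemma fibre_sndM : {morph fibre_snd : x y / (x * y)%g}.
Proof. by move=> x y; apply: gamma_inj; rewrite gmulfM !fibre_sndE. Qed.

Lemma fibre_pair g b : alpha g = alpha (gamma b) ->
  exists2 x, fibre_fst x = g & fibre_snd x = b.
Proof.
move=> gb; have gbF : (g, gamma b) \in fibre_set by apply/fibreP; exists b.
by exists (Subg gbF) => //; apply: gamma_inj; rewrite fibre_sndE.
Qed.

Lemma fibre_inj x y :
  fibre_fst x = fibre_fst y -> fibre_snd x = fibre_snd y -> x = y.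
Proof.
move=> xy1 xy2; apply: subg_inj; apply: injective_projections => //.
by rewrite -!fibre_sndE xy2.
Qed.

End FibreProduct.

(** An element of ker alpha' is a pair (g, 1), and the fibre condition then says
    that g lies in ker alpha. *)
Lemma fibre_ker (A B : groupType) (G : finGroupType)
    (alpha : {multiplicative G -> A}) (gamma : {multiplicative B -> G})
    (alpha' : {multiplicative fibre alpha gamma -> B}) :
    injective gamma -> alpha' =1 @fibre_snd A B G alpha gamma ->
  gker alpha \isog gker alpha'.
Proof.
move=> gamma_inj alpha'E.
rewrite isog_sym; apply/isogP.
have fM : {in gker alpha' &,
    {morph @fibre_fst _ _ _ alpha gamma : x y / (x * y)%g}}.
  by move=> x y _ _; apply: gmulfM.
exists (Morphism fM).
  apply/injmP => x y; rewrite !inE !alpha'E => /eqP x1 /eqP y1 xy.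
  by apply: fibre_inj; rewrite ?x1 ?y1.
apply/setP => g; rewrite !inE; apply/morphimP/eqP => [[x _ xK ->]|g1].
  move: xK; rewrite inE alpha'E /= fibre_eq => /eqP->.
  by rewrite !multiplicative1.
have [|x xg x1] := @fibre_pair _ _ _ alpha gamma gamma_inj g 1%g.
  by rewrite !multiplicative1.
have xK : x \in gker alpha' by rewrite inE alpha'E x1.
by exists x.
Qed.

(** * Reduction to a split embedding problem *)

Theorem proposition5p2 (H : divRingType) (hH : finite_over_center H)
    (L : extension H) (G : finGroupType) (alpha : {multiplicative G -> Gal L})
    (halpha : embedding_problem alpha)
    (L' : extension H) (i : ext_sub L L')
    (gamma : {multiplicative Gal L' -> G})
    (hgamma : weak_solution alpha i gamma) :
  exists (G' : finGroupType) (alpha' : {multiplicative G' -> Gal L'}),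
    [/\ embedding_problem alpha',
        split_problem alpha',
        gker alpha \isog gker alpha'
      & forall (F' : extension H) (i' : ext_sub L' F')
          (beta' : {multiplicative Gal F' -> G'}),
          solution alpha' i' beta' ->
          exists (F : extension H) (j : ext_sub L F) (k : ext_sub F F')
            (beta : {multiplicative Gal F -> G}),
            (forall x : L, k (j x) = i' (i x)) /\ solution alpha j beta].
Proof.
have [galL alpha_surj] := halpha.
have [galL' gamma_inj gamma_res] := hgamma.
have finL' : finite_set [set: Gal L'].
  rewrite -(eq_finite_set (inj_card_eq (in2W gamma_inj))).
  exact: finite_finset.
pose G' := fibre alpha gamma.
pose alpha' : {multiplicative G' -> Gal L'} := HB.pack
  (@fibre_snd _ _ _ alpha gamma)
  (isMultiplicative.Build G' (Gal L') _
     (@fibre_sndM _ _ _ alpha gamma gamma_inj)).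
pose sigma s : G' := Subg (introT (@fibreP _ _ _ alpha gamma (gamma s, gamma s))
  (ex_intro2 _ _ s erefl erefl)).
have sigmaK s : alpha' (sigma s) = s.
  by apply: (gamma_inj); rewrite /= fibre_sndE.
have sigmaM : {morph sigma : s t / (s * t)%g}.
  by move=> s t; apply: subg_inj; rewrite /= gmulfM.
exists G', alpha'; split.
- by split=> // s; exists (sigma s).
- exists (HB.pack_for {multiplicative Gal L' -> G'} sigma
    (isMultiplicative.Build _ _ sigma sigmaM)) => //.
  exact: can_inj sigmaK.
- exact: fibre_ker.
move=> F' i' beta' [[galF' beta'_inj beta'_res] [beta'V beta'K beta'VK]].
have finF' : finite_set [set: Gal F'].
  rewrite -(eq_finite_set (inj_card_eq (in2W beta'_inj))).
  exact: finite_finset.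
have outF' := finite_outer hH galF' finF'.
have outL' := finite_outer hH galL' finL'.
have phiM : {morph (fun s => fibre_fst (beta' s)) : s t / (s * t)%g}.
  by move=> s t; rewrite !gmulfM.
pose phi : {multiplicative Gal F' -> G} := HB.pack
  (fun s => fibre_fst (beta' s)) (isMultiplicative.Build _ _ _ phiM).
have := galois_quotient phi outF' galF' finF'.
set K := [set s | _]%classic; set k := fixed_incl K.
case=> galF [beta [beta_inj resF secF betaE]].
have phi_res (s : Gal F') (x : L) : s (i' (i x)) = i' (i (alpha (phi s) x)).
  by rewrite beta'_res gamma_res /= fibre_eq.
(* By phi_res the kernel of phi acts trivially on L, hence L embeds in F. *)
have i'iE h : (i' \o i) (ext_incl L h) = ext_incl F' h.
  by rewrite /= !ext_subE.
have [x|j kjE] := @fixed_lift _ _ K L (ExtSub i'iE).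
  by apply/fixed_byP => s Ks; rewrite phi_res Ks multiplicative1.
exists (fixed_ext K), j, k, beta; split=> //.
split.
  split=> // t x; apply: (@ext_sub_inj _ _ _ k); have [s st] := secF t.
  by rewrite -st !kjE (betaE _ _ st); apply: phi_res.
(* Some s in Gal(L'/H) restricts to alpha g on L, so that (g, s) is an element
   of the fibre product; its preimage under beta' restricts on F to a preimage
   of g under beta. *)
have beta_surj g : exists t, beta t = g.
  have [s sg] : exists s, is_restriction i s (alpha g).
    apply: restriction_surj => // s.
    by exists (alpha (gamma s)); apply: gamma_res.
  have gs : alpha g = alpha (gamma s).
    exact: restriction_inj sg (gamma_res s).
  have [y yg ys] := fibre_pair gamma_inj gs.
  have [t tP] := resF (beta'V y).
  by exists t; rewrite (betaE _ _ tP) /= beta'VK.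
have [betaV betaVK] := choice beta_surj.
by exists betaV => // t; apply: beta_inj; rewrite betaVK.
Qed.
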